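(* Let $\mathbb{K}=\mathbb{R}$ or $\mathbb{K}=\mathbb{C}$, let $W\in\mathbb{K}^{m\times n}$, and let $X\in\mathbb{K}^{n\times m}$ satisfy $XWW^*WX=W^*$. Then $$XWX=W^+.$$
   Context: $W^*$ denotes the conjugate transpose (transpose over $\mathbb{R}$) and $W^+$ the Moore--Penrose pseudoinverse of $W$. *)

(* Defs.v *)
From mathcomp Require Import all_boot all_order all_algebra.
From mathcomp Require Import complex reals.

Set Implicit Arguments.
Unset Strict Implicit.
Unset Printing Implicit Defensive.

Import Order.TTheory GRing.Theory Num.Theory.
Local Open Scope ring_scope.
Local Open Scope sesquilinear_scope.

(* The Penrose equations, relative to an adjoint operation on matrices: [star]
   is transposition over a real field and conjugate transposition over a
   complex one. MathComp's [pinvmx] is only a partial inverse on the row space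
   and does not satisfy them in general. *)
Definition is_mpinv (K : fieldType)
    (star : forall m n, 'M[K]_(m, n) -> 'M[K]_(n, m))
    (m n : nat) (W : 'M[K]_(m, n)) (P : 'M[K]_(n, m)) : bool :=
  [&& W *m P *m W == W,
      P *m W *m P == P,
      star _ _ (W *m P) == W *m P
    & star _ _ (P *m W) == P *m W].

Lemma is_mpinv_unique (K : fieldType)
    (star : forall m n, 'M[K]_(m, n) -> 'M[K]_(n, m))
    (starM : forall m n p (A : 'M[K]_(m, n)) (B : 'M[K]_(n, p)),
       star _ _ (A *m B) = star _ _ B *m star _ _ A)
    (m n : nat) (W : 'M[K]_(m, n)) (P Q : 'M[K]_(n, m)) :
  is_mpinv star W P -> is_mpinv star W Q -> P = Q.
Proof.
case/and4P=> /eqP p1 /eqP p2 /eqP p3 /eqP p4.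
case/and4P=> /eqP q1 /eqP q2 /eqP q3 /eqP q4.
have eL : W *m P = W *m Q.
  rewrite -p3 -{1}q1 -(mulmxA (W *m Q)) starM p3 q3.
  by rewrite (mulmxA (W *m P)) p1.
have eR : P *m W = Q *m W.
  rewrite -p4 -{1}q1 -(mulmxA W) (mulmxA P) starM p4 q4.
  by rewrite -(mulmxA Q) (mulmxA W P) p1.
by rewrite -p2 eR -mulmxA eL mulmxA.
Qed.

Lemma is_mpinv_exists (K : fieldType)
    (star : forall m n, 'M[K]_(m, n) -> 'M[K]_(n, m))
    (starK : forall m n (A : 'M[K]_(m, n)), star _ _ (star _ _ A) = A)
    (starM : forall m n p (A : 'M[K]_(m, n)) (B : 'M[K]_(n, p)),
       star _ _ (A *m B) = star _ _ B *m star _ _ A)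
    (star_def : forall n (v : 'rV[K]_n), v *m star _ _ v = 0 -> v = 0)
    (m n : nat) (W : 'M[K]_(m, n)) :
  exists P, is_mpinv star W P.
Proof.
have star0 p q : star p q 0 = 0.
  have := starM p 0%N q 0 0; rewrite mul0mx => ->.
  by rewrite [star 0%N q 0]thinmx0 mul0mx.
have star1 p : star p p 1%:M = 1%:M.
  by have := starM _ _ _ (star p p 1%:M) 1%:M; rewrite mulmx1 starK mulmx1.
have starI p (A : 'M[K]_p) : A \in unitmx -> star _ _ A = A ->
    star _ _ (invmx A) = invmx A.
  move=> uA sA; have := starM _ _ _ A (invmx A).
  rewrite mulmxV // star1 sA => /(congr1 (mulmx^~ (invmx A))).
  by rewrite mul1mx mulmxK.
have gram_unit p q (C : 'M[K]_(p, q)) : row_free C -> C *m star _ _ C \in unitmx.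
  move=> fC; rewrite -row_free_unit; apply: inj_row_free => v vG0.
  apply: (row_free_inj fC); rewrite mul0mx; apply: star_def.
  by rewrite starM mulmxA -(mulmxA v) vG0 mul0mx.
set r := \rank W.
pose B : 'M[K]_(m, r) := col_base W; pose C : 'M[K]_(r, n) := row_base W.
have WE : W = B *m C by rewrite /B /C mulmx_base.
have uC : C *m star _ _ C \in unitmx by apply/gram_unit/row_base_free.
have uB : star _ _ B *m B \in unitmx.
  have := gram_unit _ _ (star _ _ B); rewrite starK; apply.
  apply: inj_row_free => v /(congr1 (@star _ _)); rewrite starM starK star0.
  case/row_fullP: (col_base_full W) => L LB /(congr1 (mulmx L)).
  rewrite mulmxA LB mul1mx mulmx0 => /(congr1 (@star _ _)).
  by rewrite starK star0.
clearbody B C.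
set G := C *m star _ _ C in uC; set H := star _ _ B *m B in uB.
have sG : star _ _ G = G by rewrite /G starM starK.
have sH : star _ _ H = H by rewrite /H starM starK.
pose P := star _ _ C *m invmx G *m (invmx H *m star _ _ B).
have WP : W *m P = B *m invmx H *m star _ _ B.
  rewrite WE /P -(mulmxA B) (mulmxA C) (mulmxA C) -/G mulmxV // mul1mx.
  by rewrite mulmxA.
have PW : P *m W = star _ _ C *m invmx G *m C.
  rewrite WE /P -(mulmxA (_ *m invmx G)) (mulmxA (_ *m star _ _ B) B).
  by rewrite -(mulmxA (invmx H)) -/H mulVmx // mul1mx.
exists P; apply/and4P; split; apply/eqP.
- by rewrite WP WE mulmxA -(mulmxA _ _ B) -/H -(mulmxA B (invmx H)) mulVmx //
     mulmx1.
- rewrite PW /P [LHS]mulmxA; congr (_ *m _).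
  by rewrite -(mulmxA _ C) (mulmxA C) -/G mulmxV // mulmx1.
- by rewrite WP !starM starK (starI _ H) // mulmxA.
- by rewrite PW !starM starK (starI _ G) // mulmxA.
Qed.

Lemma mpinvR_exists (R : realFieldType) (m n : nat) (W : 'M[R]_(m, n)) :
  exists P, is_mpinv (fun p q A => A^T) W P.
Proof.
apply: is_mpinv_exists => [p q A | p q s A B | p v /matrixP/(_ 0 0)].
- exact: trmxK.
- exact: trmx_mul.
rewrite !mxE => /eqP; rewrite psumr_eq0 => [/allP v0|i _]; last first.
  by rewrite mxE -expr2 sqr_ge0.
apply/rowP=> i; have := v0 i (mem_index_enum i).
by rewrite !mxE mulf_eq0 orbb => /eqP.
Qed.

Lemma mpinvC_exists (C : numClosedFieldType) (m n : nat) (W : 'M[C]_(m, n)) :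
  exists P, is_mpinv (fun p q A => A ^t*) W P.
Proof.
apply: is_mpinv_exists => [p q A | p q s A B | p v /matrixP/(_ 0 0)].
- exact: trmxCK.
- by rewrite trmx_mul map_mxM.
rewrite !mxE => /eqP; rewrite psumr_eq0 => [/allP v0|i _]; last first.
  by rewrite !mxE mul_conjC_ge0.
apply/rowP=> i; have := v0 i (mem_index_enum i).
by rewrite !mxE mul_conjC_eq0 => /eqP.
Qed.

Definition mpinvR (R : realFieldType) (m n : nat) (W : 'M[R]_(m, n)) :
  'M[R]_(n, m) := xchoose (mpinvR_exists W).

Definition mpinvC (C : numClosedFieldType) (m n : nat) (W : 'M[C]_(m, n)) :
  'M[C]_(n, m) := xchoose (mpinvC_exists W).

Lemma mpinvRP (R : realFieldType) (m n : nat) (W : 'M[R]_(m, n)) P :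
  is_mpinv (fun p q A => A^T) W P <-> P = mpinvR W.
Proof.
have h := xchooseP (mpinvR_exists W); split=> [hP|->//].
by apply: is_mpinv_unique hP h => p q s A B; exact: trmx_mul.
Qed.

Lemma mpinvCP (C : numClosedFieldType) (m n : nat) (W : 'M[C]_(m, n)) P :
  is_mpinv (fun p q A => A ^t*) W P <-> P = mpinvC W.
Proof.
have h := xchooseP (mpinvC_exists W); split=> [hP|->//].
by apply: is_mpinv_unique hP h => p q s A B; rewrite trmx_mul map_mxM.
Qed.

(* Main.v *)
Require Import Defs.
From mathcomp Require Import all_boot all_order all_algebra.
From mathcomp Require Import complex reals.

Set Implicit Arguments.
Unset Strict Implicit.
Unset Printing Implicit Defensive.

Import Order.TTheory GRing.Theory Num.Theory.
Local Open Scope ring_scope.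
Local Open Scope sesquilinear_scope.

(** Write [A'] for the adjoint of a matrix [A].  The heart of the matter is the
    identity [W X W X W = W].  Put [H = W' W], [A = X W] and [U = H A].
    Multiplied by [W] on the right, the hypothesis reads [A H A = H], whence
    [U U = H H], so that [U] commutes with [H H].  A matrix commuting with the
    square of a positive semidefinite [H] commutes with [H] itself: the
    commutator [D = U H - H U] satisfies [H D = - D H], and comparing the traces
    of [D' H D] and [- D H D'], of opposite signs, forces [W D = 0]
    ([gram_anticomm0]).  Hence [H H H A A = H U U = H H H], and as the factor
    [W'] can be cancelled in front of [W] and conversely ([gram_cancel]), this
    leaves [W A A = W].

    Once [M = X W X] is known to satisfy [W M W = W], the identity [M W M = M]
    is immediate.  The hypothesis shows moreover that [M W] and [W M] fix [W'],
    from the left and from the right respectively, which makes them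
    self-adjoint.  The four Penrose equations thus hold for [M].

    The real and the complex case only differ in the adjoint, and the argument
    uses no more than the positive definiteness of the trace form
    [tr (A' A)]; it is carried out for any such adjoint. *)

(** What transposition over an ordered field and conjugate transposition over
    the complex numbers have in common: [tr (A' A)] is the sum of the squared
    moduli of the entries of [A]. *)
Record positive_adjoint (K : numFieldType)
    (star : forall m n, 'M[K]_(m, n) -> 'M[K]_(n, m)) : Prop :=
  PositiveAdjoint {
    adjK : forall m n (A : 'M[K]_(m, n)), star _ _ (star _ _ A) = A;
    adjM : forall m n p (A : 'M[K]_(m, n)) (B : 'M[K]_(n, p)),
      star _ _ (A *m B) = star _ _ B *m star _ _ A;
    adj_ge0 : forall m n (A : 'M[K]_(m, n)), 0 <= \tr (star _ _ A *m A);
    adj_eq0 : forall m n (A : 'M[K]_(m, n)),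
      \tr (star _ _ A *m A) = 0 -> A = 0 }.

Arguments adjK {K star} _ {m n}.
Arguments adjM {K star} _ {m n p}.
Arguments adj_ge0 {K star} _ {m n}.
Arguments adj_eq0 {K star} _ {m n}.

Lemma trmx_positive_adjoint (R : realFieldType) :
  @positive_adjoint R (fun p q A => A^T).
Proof.
have trE m n (A : 'M[R]_(m, n)) :
    \tr (A^T *m A) = \sum_j \sum_i A i j ^+ 2.
  by apply: eq_bigr => j _; rewrite !mxE; apply: eq_bigr => i _; rewrite mxE.
split=> [m n A|m n p A B|m n A|m n A]; rewrite ?trE.
- exact: trmxK.
- exact: trmx_mul.
- by do 2![apply: sumr_ge0 => ? _]; exact: sqr_ge0.
- move/psumr_eq0P=> A0; apply/matrixP=> i j; rewrite mxE.
  have {}A0 : \sum_i A i j ^+ 2 = 0.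
    by apply: A0 => // k _; apply: sumr_ge0 => ? _; exact: sqr_ge0.
  apply/eqP; rewrite -sqrf_eq0; apply/eqP.
  by apply: (psumr_eq0P _ A0) => // k _; exact: sqr_ge0.
Qed.

Lemma trmxC_positive_adjoint (C : numClosedFieldType) :
  @positive_adjoint C (fun p q A => A ^t*).
Proof.
have trE m n (A : 'M[C]_(m, n)) :
    \tr (A ^t* *m A) = \sum_j \sum_i `|A i j| ^+ 2.
  apply: eq_bigr => j _; rewrite !mxE; apply: eq_bigr => i _.
  by rewrite !mxE normCK mulrC.
split=> [m n A|m n p A B|m n A|m n A]; rewrite ?trE.
- exact: trmxCK.
- by rewrite trmx_mul map_mxM.
- by do 2![apply: sumr_ge0 => ? _]; exact: exprn_ge0.
- move/psumr_eq0P=> A0; apply/matrixP=> i j; rewrite mxE.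
  have {}A0 : \sum_i `|A i j| ^+ 2 = 0.
    by apply: A0 => // k _; apply: sumr_ge0 => ? _; exact: exprn_ge0.
  apply/eqP; rewrite -normr_eq0 -sqrf_eq0; apply/eqP.
  by apply: (psumr_eq0P _ A0) => // k _; exact: exprn_ge0.
Qed.

Lemma gram_cancel (K : numFieldType)
    (star : forall m n, 'M[K]_(m, n) -> 'M[K]_(n, m))
    (adj : positive_adjoint star) (m n p : nat)
    (W : 'M[K]_(m, n)) (Y : 'M[K]_(n, p)) :
  star _ _ W *m W *m Y = 0 -> W *m Y = 0.
Proof.
move=> WWY0; apply: (adj_eq0 adj).
by rewrite (adjM adj) -mulmxA (mulmxA (star _ _ W)) WWY0 mulmx0 mxtrace0.
Qed.

(** Cancels alternately [W'] in front of [W] and [W] in front of [W'], the latter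
    being [gram_cancel] for the matrix [W']. *)
Lemma gram_sq_cancel (K : numFieldType)
    (star : forall m n, 'M[K]_(m, n) -> 'M[K]_(n, m))
    (adj : positive_adjoint star) (m n p : nat)
    (W : 'M[K]_(m, n)) (Y : 'M[K]_(n, p)) (H := star _ _ W *m W) :
  H *m (H *m Y) = 0 -> H *m Y = 0.
Proof.
move/(gram_cancel adj); rewrite /H !mulmxA -{1}(adjK adj W) -mulmxA.
by move/(gram_cancel adj); rewrite mulmxA.
Qed.

(** The eigenvalues of [H = W' W] are nonnegative, so [H] and [- H] can only be
    intertwined by a [D] that [H] kills.  Traces prove this without
    diagonalizing [H]: by cyclicity [tr (D' H D) = - tr (D' D H) = - tr (D H D')],
    where the outer traces are the squared norms of [W D] and of [W D']. *)
Lemma gram_anticomm0 (K : numFieldType)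
    (star : forall m n, 'M[K]_(m, n) -> 'M[K]_(n, m))
    (adj : positive_adjoint star) (m n : nat)
    (W : 'M[K]_(m, n)) (D : 'M[K]_n) :
  star _ _ W *m W *m D = - (D *m (star _ _ W *m W)) -> W *m D = 0.
Proof.
move=> HD; apply: (adj_eq0 adj); apply/eqP; rewrite eq_le (adj_ge0 adj) andbT.
rewrite (adjM adj) -mulmxA (mulmxA (star _ _ W)) HD mulmxN raddfN /=.
rewrite mxtrace_mulC -mulmxA oppr_le0.
by have := adj_ge0 adj (W *m star _ _ D); rewrite (adjM adj) (adjK adj) !mulmxA.
Qed.

(** The commutator [D = U H - H U] anticommutes with [H]: the two products add up
    to the commutator of [U] with [H H]. *)
Lemma gram_square_comm (K : numFieldType)
    (star : forall m n, 'M[K]_(m, n) -> 'M[K]_(n, m))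
    (adj : positive_adjoint star) (m n : nat)
    (W : 'M[K]_(m, n)) (U : 'M[K]_n) (H := star _ _ W *m W) :
  U *m (H *m H) = H *m H *m U -> H *m (U *m H) = H *m (H *m U).
Proof.
move=> UHH; have WD0 : W *m (U *m H - H *m U) = 0.
  apply: (gram_anticomm0 adj).
  by rewrite -/H mulmxBr mulmxBl opprB -(mulmxA U) UHH !mulmxA.
apply/eqP; rewrite -subr_eq0 -mulmxBr; apply/eqP.
by rewrite {1}/H -mulmxA WD0 mulmx0.
Qed.

(** If [E = M W] fixes [W'], taking adjoints gives [W E' = W], so that
    [E = M W E' = E E'] is self-adjoint. *)
Lemma selfadjoint_fixl (K : numFieldType)
    (star : forall m n, 'M[K]_(m, n) -> 'M[K]_(n, m))
    (adj : positive_adjoint star) (m n : nat)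
    (W : 'M[K]_(m, n)) (M : 'M[K]_(n, m)) :
  M *m W *m star _ _ W = star _ _ W -> star _ _ (M *m W) = M *m W.
Proof.
move=> /(congr1 (@star _ _)); rewrite (adjM adj) (adjK adj) => WE.
have EE : M *m W = M *m W *m star _ _ (M *m W) by rewrite -mulmxA WE.
by rewrite EE (adjM adj) (adjK adj).
Qed.

Lemma selfadjoint_fixr (K : numFieldType)
    (star : forall m n, 'M[K]_(m, n) -> 'M[K]_(n, m))
    (adj : positive_adjoint star) (m n : nat)
    (W : 'M[K]_(m, n)) (M : 'M[K]_(n, m)) :
  star _ _ W *m (W *m M) = star _ _ W -> star _ _ (W *m M) = W *m M.
Proof.
move=> /(congr1 (@star _ _)); rewrite (adjM adj) (adjK adj) => FW.
have FF : W *m M = star _ _ (W *m M) *m (W *m M) by rewrite mulmxA FW.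
by rewrite FF (adjM adj) (adjK adj).
Qed.

Lemma sandwich_ginv (K : numFieldType)
    (star : forall m n, 'M[K]_(m, n) -> 'M[K]_(n, m))
    (adj : positive_adjoint star) (m n : nat)
    (W : 'M[K]_(m, n)) (X : 'M[K]_(n, m)) :
  X *m W *m star _ _ W *m W *m X = star _ _ W ->
  W *m X *m W *m X *m W = W.
Proof.
move=> hX; set H := star _ _ W *m W; set A := X *m W.
have AHA : A *m H *m A = H by rewrite /A /H -{2}hX !mulmxA.
have UU : H *m A *m (H *m A) = H *m H by rewrite -mulmxA (mulmxA A) AHA.
have HUH : H *m (H *m A *m H) = H *m (H *m (H *m A)).
  by apply: (gram_square_comm adj); rewrite -/H -UU mulmxA.
have HHH : H *m (H *m (H *m (A *m A - 1%:M))) = 0.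
  rewrite mulmxBr !mulmxBr mulmx1; apply/eqP; rewrite subr_eq0 -UU; apply/eqP.
  by have := congr1 (mulmx^~ A) HUH; rewrite !mulmxA.
have : W *m (A *m A - 1%:M) = 0.
  apply/(gram_cancel adj)/(gram_sq_cancel adj).
  exact: (gram_sq_cancel adj).
by rewrite mulmxBr mulmx1 => /eqP; rewrite subr_eq0 /A !mulmxA => /eqP.
Qed.

Lemma sandwich_is_mpinv (K : numFieldType)
    (star : forall m n, 'M[K]_(m, n) -> 'M[K]_(n, m))
    (adj : positive_adjoint star) (m n : nat)
    (W : 'M[K]_(m, n)) (X : 'M[K]_(n, m)) :
  X *m W *m star _ _ W *m W *m X = star _ _ W ->
  is_mpinv star W (X *m W *m X).
Proof.
move=> hX; have WXWXW := sandwich_ginv adj hX.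
have WMW : W *m (X *m W *m X) *m W = W by rewrite !mulmxA.
(* The hypothesis factors [W'] as [(X W) W' (W X)], so [M = X W X] is such that
   [M W] and [W M] fix [W'] as soon as they fix [X W] and [W X] respectively. *)
have AAA : X *m W *m X *m W *m (X *m W) = X *m W.
  by rewrite -[in RHS]WXWXW !mulmxA.
have BBB : W *m X *m (W *m (X *m W *m X)) = W *m X.
  by rewrite !mulmxA WXWXW.
apply/and4P; split; apply/eqP; first exact: WMW.
- by rewrite -[in RHS]WXWXW !mulmxA.
- apply: (selfadjoint_fixr adj).
  by rewrite -{1}hX -(mulmxA _ W X) -mulmxA BBB mulmxA.
- apply: (selfadjoint_fixl adj).
  by rewrite -{1}hX !mulmxA -(mulmxA _ X W) AAA.
Qed.

Theorem corollary5p2 (R : realType) (m n : nat) :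
  (forall (W : 'M[R]_(m, n)) (X : 'M[R]_(n, m)),
     X *m W *m W^T *m W *m X = W^T ->
     X *m W *m X = mpinvR W)
  /\
  (forall (W : 'M[R[i]%C]_(m, n)) (X : 'M[R[i]%C]_(n, m)),
     X *m W *m W ^t* *m W *m X = W ^t* ->
     X *m W *m X = mpinvC W).
Proof.
split=> W X hX.
- exact/mpinvRP/(sandwich_is_mpinv (trmx_positive_adjoint R)).
- exact/mpinvCP/(sandwich_is_mpinv (trmxC_positive_adjoint R[i]%C)).
Qed.
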